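(* Let $X$ be a normed space and $\Omega\subset X$ open. Suppose that: (1) $H$ is a linear subspace of $\mathbb{R}^X$ (the space of all functions $X\to\mathbb{R}$); (2) functions $F_i\colon\Omega\to\mathbb{R}$, $i\in I=\{1,\ldots,d\}$, are weakly $H$-codifferentiable at a point $x\in\Omega$; (3) the weak $H$-derivatives $\delta(F_i)_H[x]$, $i\in I$, are Lipschitz continuous in a neighbourhood of zero; (4) $S\subset\mathbb{R}^d$ is an open set such that $y=(F_1(x),\ldots,F_d(x))\in S$; (5) a function $g\colon S\to\mathbb{R}$ is differentiable at $y$; (6) the function $T(\cdot)=g(F_1(\cdot),\ldots,F_d(\cdot))$ is defined on an open set $\mathcal{O}\subset\Omega$ with $x\in\mathcal{O}$. Then $T$ is weakly $H$-codifferentiable at $x$ and $$\delta T_H[x]=\sum_{i\in I}\frac{\partial g}{\partial y_i}(y)\,\delta(F_i)_H[x],\qquad D^w_HT(x)=\sum_{i\in I}\frac{\partial g}{\partial y_i}(y)\,D^w_HF_i(x).$$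
   Context: $\overline{\mathbb{R}}=\mathbb{R}\cup\{\pm\infty\}$; for $f\colon X\to\overline{\mathbb{R}}$, $\operatorname{dom}f=\{x: f(x)\in\mathbb{R}\}$. A function $X\to\overline{\mathbb{R}}$ is $H$-convex (resp. $H$-concave) if it is the pointwise supremum (resp. infimum) of a nonempty subset of $H$; it is said to be generated by that subset. $PF(X,\overline{\mathbb{R}},H)$ is the set of pairs $(\Phi,\Psi)$ with $\Phi$ $H$-convex, $\Psi$ $H$-concave, and $\operatorname{dom}\Phi\cap\operatorname{dom}\Psi$ containing a neighbourhood of $0$. The equivalence relation $\sigma_w$ on it: $(\Phi_1,\Psi_1)\,\sigma_w\,(\Phi_2,\Psi_2)$ iff $\Phi_1(0)+\Psi_1(0)=\Phi_2(0)+\Psi_2(0)$ and for every $v\in X$, $\frac1\alpha(\Phi_1(\alpha v)+\Psi_1(\alpha v)-\Phi_2(\alpha v)-\Psi_2(\alpha v))\to0$ as $\alpha\downarrow0$. The class of $(\Phi,\Psi)$ is $[\Phi,\Psi]_w$. For pairs $(U,V)$ of nonempty subsets of $H$ with $(\sup_{h\in U}h,\inf_{p\in V}p)\in PF(X,\overline{\mathbb{R}},H)$, $[U,V]_w$ is the class of $(U,V)$ under the relation ''the associated pairs $(\sup_Uh,\inf_Vp)$ are $\sigma_w$-equivalent''. Operations: $[\Phi_1,\Psi_1]_w+[\Phi_2,\Psi_2]_w=[\Phi_1+\Phi_2,\Psi_1+\Psi_2]_w$; $\alpha[\Phi,\Psi]_w=[\alpha\Phi,\alpha\Psi]_w$ if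 $\alpha>0$, $[\alpha\Psi,\alpha\Phi]_w$ if $\alpha<0$, $[0,0]_w$ if $\alpha=0$. Similarly $[U_1,V_1]_w+[U_2,V_2]_w=[U_1+U_2,V_1+V_2]_w$ (Minkowski sums); $\alpha[U,V]_w=[\alpha U,\alpha V]_w$ if $\alpha>0$, $[\alpha V,\alpha U]_w$ if $\alpha<0$, $[\{0\},\{0\}]_w$ if $\alpha=0$. A function $F\colon\Omega\to\mathbb{R}$ is weakly $H$-codifferentiable at $x\in\Omega$ if there is $(\Phi,\Psi)\in PF(X,\overline{\mathbb{R}},H)$ with $\Phi(0)+\Psi(0)=0$ such that for every $\Delta x\in X$ with $\operatorname{co}\{x,x+\Delta x\}\subset\Omega$ and $\operatorname{co}\{0,\Delta x\}\subset\operatorname{dom}\Phi\cap\operatorname{dom}\Psi$ one has $F(x+\Delta x)-F(x)=\Phi(\Delta x)+\Psi(\Delta x)+o(\Delta x,x)$, where $o(\alpha\Delta x,x)/\alpha\to0$ as $\alpha\downarrow0$. The (unique) class $\delta F_H[x]=[\Phi,\Psi]_w$ is the weak $H$-derivative of $F$ at $x$. If $\Phi$ is generated by $U\subset H$ and $\Psi$ by $V\subset H$, then $D^w_HF(x)=[U,V]_w$ is the weak $H$-codifferential (independent of choices). $\delta F_H[x]$ is Lipschitz continuous in a neighbourhood of zero if there is $(\Phi,\Psi)\in\delta F_H[x]$ with $\Phi$ and $\Psi$ Lipschitz continuous in a neighbourhood of zero. *)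

(* Defs.v *)
From HB Require Import structures.
From mathcomp Require Import all_boot all_order all_algebra.
From mathcomp Require Import all_classical all_reals all_analysis.

Set Implicit Arguments.
Unset Strict Implicit.
Unset Printing Implicit Defensive.

Import Order.TTheory GRing.Theory Num.Theory.
Import numFieldNormedType.Exports.

Local Open Scope classical_set_scope.
Local Open Scope ring_scope.

Section Codifferentials.
Context {R : realType} {X : normedModType R}.
Implicit Types (H U V : set (X -> R^o)) (f : X -> \bar R).

(* A linear subspace of the space of all functions X -> R; R^o is R viewed as
   a module over itself. *)
Definition linear_subspace H := submod_closed (mem H).

Definition edom f : set X := [set v | f v \is a fin_num].

Definition co (A : set X) : set X :=
  smallest (fun C : set X => convex_set (C : set (convex_lmodType X))) A.

Definition sup_fun U : X -> \bar R :=
  fun v => ereal_sup [set (h v)%:E | h in U].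
Definition inf_fun V : X -> \bar R :=
  fun v => ereal_inf [set (h v)%:E | h in V].

Definition generates_convex H U f :=
  [/\ U `<=` H, U !=set0 & f = sup_fun U].
Definition generates_concave H V f :=
  [/\ V `<=` H, V !=set0 & f = inf_fun V].

Definition Hconvex H f := exists U, generates_convex H U f.
Definition Hconcave H f := exists V, generates_concave H V f.

Definition fpair : Type := ((X -> \bar R) * (X -> \bar R))%type.
Definition spair : Type := (set (X -> R^o) * set (X -> R^o))%type.

Definition PF H : set fpair :=
  [set p | [/\ Hconvex H p.1, Hconcave H p.2 &
               nbhs 0 (edom p.1 `&` edom p.2)]].

(* For p and q in PF, all the values of p and q occurring in the limit are
   finite as soon as a is small enough. *)
Definition sigma_w (p q : fpair) : Prop :=
  (p.1 0%R + p.2 0%R = q.1 0%R + q.2 0%R)%E /\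
  forall v : X,
    ((a^-1)%:E * (p.1 (a *: v) + p.2 (a *: v) - q.1 (a *: v) - q.2 (a *: v)))%E
      @[a --> (0 : R)^'+] --> 0%E.

Definition fclass H (p : fpair) : set fpair := [set q | PF H q /\ sigma_w p q].

Definition fpair_of (s : spair) : fpair := (sup_fun s.1, inf_fun s.2).

Definition PFset H : set spair :=
  [set s | [/\ s.1 `<=` H, s.1 !=set0, s.2 `<=` H, s.2 !=set0 &
               PF H (fpair_of s)]].

Definition sclass H (s : spair) : set spair :=
  [set t | PFset H t /\ sigma_w (fpair_of s) (fpair_of t)].

Definition fpair_zero : fpair := (cst 0%E, cst 0%E).

Definition fpair_add (p q : fpair) : fpair :=
  ((fun v => p.1 v + q.1 v)%E, (fun v => p.2 v + q.2 v)%E).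

Definition fpair_scale (a : R) (p : fpair) : fpair :=
  if 0 < a then ((fun v => a%:E * p.1 v)%E, (fun v => a%:E * p.2 v)%E)
  else if a < 0 then ((fun v => a%:E * p.2 v)%E, (fun v => a%:E * p.1 v)%E)
  else fpair_zero.

Definition spair_zero : spair := ([set 0], [set 0]).

Definition spair_add (s t : spair) : spair :=
  ([set h + k | h in s.1 & k in t.1], [set h + k | h in s.2 & k in t.2]).

Definition spair_scale (a : R) (s : spair) : spair :=
  if 0 < a then ([set a *: h | h in s.1], [set a *: h | h in s.2])
  else if a < 0 then ([set a *: h | h in s.2], [set a *: h | h in s.1])
  else spair_zero.

(* The operations on classes apply the operation to representatives; when H is
   a linear subspace the result does not depend on them, so each union below is
   a union of copies of one class. *)
Definition fclass_zero H : set fpair := fclass H fpair_zero.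
Definition fclass_add H (A B : set fpair) : set fpair :=
  \bigcup_(p in A) \bigcup_(q in B) fclass H (fpair_add p q).
Definition fclass_scale H (a : R) (A : set fpair) : set fpair :=
  \bigcup_(p in A) fclass H (fpair_scale a p).

Definition sclass_zero H : set spair := sclass H spair_zero.
Definition sclass_add H (A B : set spair) : set spair :=
  \bigcup_(s in A) \bigcup_(t in B) sclass H (spair_add s t).
Definition sclass_scale H (a : R) (A : set spair) : set spair :=
  \bigcup_(s in A) sclass H (spair_scale a s).

(* F stands for a function on Omega: for x in Omega, only its values on Omega
   matter. *)
Definition weak_expansion H (Omega : set X) (F : X -> R) (x : X) (p : fpair) :=
  [/\ PF H p,
      (p.1 0%R + p.2 0%R = 0)%E &
      exists o : X -> R, forall v : X,
        co [set x; x + v] `<=` Omega ->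
        co [set 0; v] `<=` edom p.1 `&` edom p.2 ->
        (F (x + v) - F x)%:E = (p.1 v + p.2 v + (o v)%:E)%E /\
        o (a *: v) / a @[a --> (0 : R)^'+] --> (0 : R)].

Definition weakly_codifferentiable H Omega F x :=
  exists p, weak_expansion H Omega F x p.

(* The default value set0 is taken only if F is not weakly codifferentiable;
   it is not a class. *)
Definition weak_derivative H Omega F x : set fpair :=
  xget set0 [set c | exists2 p, weak_expansion H Omega F x p & c = fclass H p].

Definition weak_codifferential H Omega F x : set spair :=
  xget set0 [set c | exists s : spair, exists p : fpair,
    [/\ weak_derivative H Omega F x p,
        generates_convex H s.1 p.1,
        generates_concave H s.2 p.2 &
        c = sclass H s]].

Definition lipschitz_near0 f :=
  exists2 N : set X, nbhs 0 N &
    N `<=` edom f /\ [lipschitz (fine (f v) : R^o) | v in N].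

Definition fclass_lipschitz (c : set fpair) :=
  exists2 p, c p & lipschitz_near0 p.1 /\ lipschitz_near0 p.2.

End Codifferentials.

(* R^d is the space of row vectors, and the partial derivative is the
   directional derivative along the i-th vector of the canonical basis. *)
Definition partial_derivative {R : realType} {d : nat} (i : 'I_d)
    (g : 'rV[R]_d -> R) (y : 'rV[R]_d) : R :=
  'D_(delta_mx 0 i) g y.

(* Main.v *)
(* Let phi_i = Phi_i + Psi_i for a Lipschitz representative of the derivative of
   F_i, and c_i = dg/dy_i (y).  Along a fixed ray, F_i(x + a v) - F_i(x) =
   phi_i(a v) + o(a), and the Lipschitz property together with phi_i(0) = 0 makes
   this increment O(a); hence the o(|h|) in the expansion of g at y is o(a), and
   T(x + a v) - T(x) = sum_i c_i phi_i(a v) + o(a).  A representative of the sum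
   of classes is obtained from generating sets, since suprema and infima are
   compatible with Minkowski sums and are exchanged by negative scalars.  All
   the values involved are finite near 0, so that the extended real relations
   reduce to real ones. *)
Require Import Defs.
From HB Require Import structures.
From mathcomp Require Import all_boot all_order all_algebra.
From mathcomp Require Import all_classical all_reals all_analysis.
From mathcomp Require Import ring lra.

Set Implicit Arguments.
Unset Strict Implicit.
Unset Printing Implicit Defensive.

Import Order.TTheory GRing.Theory Num.Theory.
Import numFieldNormedType.Exports.

Local Open Scope classical_set_scope.
Local Open Scope ring_scope.

(** * Behaviour along rays at the origin and the calculus of radial little-o *)

Section Rays.
Context {R : realType} {X : normedModType R}.
Implicit Types (N : set X) (e : X -> R) (v : X).

Lemma near_ray N v : nbhs 0 N -> \forall a \near (0 : R)^'+, N (a *: v).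
Proof.
move=> N0; have : a *: v @[a --> (0 : R)^'+] --> 0 *: v.
  apply: cvg_at_right_filter; apply: (@cvgZr_tmp R X); exact: cvg_id.
by rewrite scale0r; apply.
Qed.

(** By local convexity [N] contains a convex open [C] around [x]; such a [C] contains the hull as
    soon as it contains both endpoints, which holds for small [w]. *)
Lemma near_co_sub N x : nbhs x N -> \forall w \near 0, co [set x; x + w] `<=` N.
Proof.
have [B Bconv [Bopen Bbasis]] := @locally_convex R X.
move=> /Bbasis[C [BC Cx] CN].
have : nbhs (x + 0) C by rewrite addr0; apply: open_nbhs_nbhs; split; [exact: Bopen|].
move=> Cx0; have : \forall w \near (0 : X), C (x + w).
  by apply: (@cvgD _ _ _ _ _ (fun=> x) id x 0) Cx0; [exact: cvg_cst|exact: cvg_id].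
apply: filterS => w Cxw; apply: subset_trans CN; apply: smallest_sub.
  by apply: Bconv; rewrite inE.
by move=> _ [->|->].
Qed.

(* Littleo along each ray separately: no uniformity in the direction [v]. *)
Definition radial_littleo e := forall v (eps : R), 0 < eps ->
  \forall a \near (0 : R)^'+, `|e (a *: v)| <= eps * a.

Lemma radial_littleoP e :
  radial_littleo e <-> forall v, e (a *: v) / a @[a --> (0 : R)^'+] --> (0 : R).
Proof.
split=> [eo v|eo v eps eps0].
  apply/(@cvgr0Pnorm_le R R^o) => eps eps0.
  near=> a; have a0 : 0 < a by near: a; exact: nbhs_right_gt.
  rewrite normrM normfV (gtr0_norm a0) ler_pdivrMr//.
  by near: a; exact: eo.
have /(@cvgr0Pnorm_le R R^o)/(_ _ eps0) := eo v; apply: filter_app.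
near=> a; have a0 : 0 < a by near: a; exact: nbhs_right_gt.
by rewrite normrM normfV (gtr0_norm a0) ler_pdivrMr.
Unshelve. all: by end_near. Qed.

(** Pairs are only known to be finite near 0, so identities between their real values hold only
    there; that is enough, because each ray stays in the neighbourhood for small [a]. *)
Lemma eq_near_radial_littleo e e' :
  (\forall v \near 0, e v = e' v) -> radial_littleo e -> radial_littleo e'.
Proof.
move=> ee' eo v eps eps0; have := eo v eps eps0; apply: filter_app.
by apply: filterS (near_ray v ee') => a ->.
Qed.

Lemma radial_littleoD e e' : radial_littleo e -> radial_littleo e' ->
  radial_littleo (fun v => e v + e' v).
Proof.
move=> eo eo' v eps eps0; have e20 : 0 < eps / 2 by rewrite divr_gt0.
apply: filterS2 (eo v _ e20) (eo' v _ e20) => a ea ea'.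
by rewrite (le_trans (ler_normD _ _))// [eps]splitr mulrDl lerD.
Qed.

Lemma radial_littleoZ (k : R) e : radial_littleo e ->
  radial_littleo (fun v => k * e v).
Proof.
move=> eo v eps eps0; have k0 : 0 < `|k| + 1 by rewrite ltr_wpDl.
apply: filterS (eo v _ (divr_gt0 eps0 k0)) => a ea.
rewrite normrM (@le_trans _ _ ((`|k| + 1) * `|e (a *: v)|))//.
  by rewrite ler_wpM2r// lerDl.
by rewrite mulrC -ler_pdivlMr// mulrAC.
Qed.

Lemma radial_littleo_sum (I : finType) (f : I -> X -> R) :
  (forall i, radial_littleo (f i)) -> radial_littleo (fun v => \sum_i f i v).
Proof.
move=> fo.
suff : forall s : seq I, radial_littleo (fun v => \sum_(i <- s) f i v) by apply.
elim=> [v eps eps0|i s IH].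
  near=> a; rewrite big_nil normr0 mulr_ge0 ?ltW//.
apply: eq_near_radial_littleo (radial_littleoD (fo i) IH).
by apply: nearW => v; rewrite big_cons.
Unshelve. all: by end_near. Qed.

(* The little-o condition along [v] only depends on the ray through [v], so it
   may be checked after shrinking [v] into any neighbourhood of 0. *)
Lemma radial_littleo_dilate e N : nbhs 0 N ->
  (forall v, N v -> forall eps : R, 0 < eps ->
    \forall a \near (0 : R)^'+, `|e (a *: v)| <= eps * a) -> radial_littleo e.
Proof.
move=> N0 eo v eps eps0.
have [b [b0 Nbv]] : exists b : R, 0 < b /\ N (b *: v).
  near (0 : R)^'+ => b; exists b; split; first by near: b; exact: nbhs_right_gt.
  by near: b; exact: near_ray.
(* Since [a *: v] is [(a / b) *: (b *: v)], the tolerance [eps * b] at the shrunk vector gives back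
   [eps * b * (a / b) = eps * a]. *)
have /nbhs_ballP[d /= d0 hd] := eo _ Nbv _ (mulr_gt0 eps0 b0).
near=> a; have a0 : 0 < a by near: a; exact: nbhs_right_gt.
have ab0 : 0 < a / b by rewrite divr_gt0.
have := hd (a / b); rewrite /ball/= sub0r normrN gtr0_norm//.
rewrite scalerA divfK ?gt_eqF// => /(_ _ ab0).
rewrite [eps * b * _](_ : _ = eps * a); last by field; rewrite gt_eqF.
apply; rewrite ltr_pdivrMr//.
by near: a; apply: nbhs_right_lt; rewrite mulr_gt0.
Unshelve. all: by end_near. Qed.

End Rays.

(** * Additivity and homogeneity of suprema in the extended reals *)

Section ExtendedSuprema.
Context {R : realType} {T : Type}.
Local Open Scope ereal_scope.

Lemma ereal_sup_EFin_gtNy (A : set T) (f : T -> R) : A !=set0 ->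
  -oo < ereal_sup [set (f t)%:E | t in A].
Proof.
by move=> [t At]; apply: lt_le_trans (ereal_sup_ubound _); [exact: ltNyr (f t)|exists t].
Qed.

(** For the inequality that is not termwise, let [M] be the supremum of the sums. Nonemptiness
    excludes [-oo] and [+oo] is trivial. For finite [M], fixing [t] bounds the supremum over [A],
    and then varying [t] bounds the supremum over [B]. *)
Lemma ereal_supD (A B : set T) (f g : T -> R) : A !=set0 -> B !=set0 ->
  ereal_sup [set (f s + g t)%:E | s in A & t in B] =
  ereal_sup [set (f s)%:E | s in A] + ereal_sup [set (g t)%:E | t in B].
Proof.
move=> A0 B0; apply/eqP; rewrite eq_le; apply/andP; split.
  apply: ge_ereal_sup => _ [s As [t Bt <-]]; rewrite EFinD.
  by apply: leeD; apply: ereal_sup_ubound; [exists s|exists t].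
set M := ereal_sup [set (f s + g t)%:E | s in A & t in B].
have ubM s t : A s -> B t -> (f s + g t)%:E <= M.
  by move=> As Bt; apply: ereal_sup_ubound; exists s => //; exists t.
have sA_gt := ereal_sup_EFin_gtNy f A0.
have : -oo < M.
  have [[s As] [t Bt]] := (A0, B0).
  by apply: lt_le_trans (ubM s t As Bt); exact: ltNyr.
case: M ubM => [m| |]// ubM _; last by rewrite leey.
have sA_le t : B t -> ereal_sup [set (f s)%:E | s in A] <= (m - g t)%:E.
  move=> Bt; apply: ge_ereal_sup => _ [s As <-].
  by have := ubM s t As Bt; rewrite !lee_fin lerBrDr.
(* Finiteness is what permits moving this supremum to the other side of the inequality below. *)
have sA_fin : ereal_sup [set (f s)%:E | s in A] \is a fin_num.
  have [t Bt] := B0; rewrite fin_numElt sA_gt (le_lt_trans (sA_le t Bt))//.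
  exact: ltry.
rewrite -(fineK sA_fin) addeC -leeBrDr// -EFinB; apply: ge_ereal_sup => _ [t Bt <-].
by have := sA_le t Bt; rewrite -{1}(fineK sA_fin) !lee_fin; lra.
Qed.

Lemma ereal_sup_EFinZ (A : set T) (f : T -> R) (a : R) : (0 < a)%R ->
  ereal_sup [set (a * f t)%:E | t in A] = a%:E * ereal_sup [set (f t)%:E | t in A].
Proof.
move=> a0; rewrite -ereal_sup_pZl//; congr ereal_sup.
by rewrite image_comp; apply: eq_imagel => t _; rewrite /= EFinM.
Qed.

Lemma ereal_inf_EFinN (A : set T) (f : T -> R) :
  ereal_inf [set (f t)%:E | t in A] = - ereal_sup [set (- f t)%:E | t in A].
Proof.
by rewrite ereal_infEN image_comp; congr (- ereal_sup _); apply: eq_imagel.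
Qed.

End ExtendedSuprema.

(** * Suprema and infima of sets of functions under Minkowski operations *)

Section SupInfFun.
Context {R : realType} {X : normedModType R}.
Implicit Types (U V : set (X -> R^o)) (v : X).
Local Open Scope ereal_scope.

Lemma sup_fun_add U1 U2 v : U1 !=set0 -> U2 !=set0 ->
  sup_fun [set h + k | h in U1 & k in U2]%R v = sup_fun U1 v + sup_fun U2 v.
Proof.
move=> U10 U20.
rewrite /sup_fun -(ereal_supD (fun h : X -> R^o => h v) (fun h : X -> R^o => h v))//.
congr ereal_sup; apply/seteqP; split.
- by move=> _ [_ [h Uh [k Uk <-]] <-]; exists h => //; exists k.
- by move=> _ [h Uh [k Uk <-]]; exists (h + k)%R => //; exists h => //; exists k.
Qed.

Lemma inf_fun_add V1 V2 v : V1 !=set0 -> V2 !=set0 ->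
  inf_fun [set h + k | h in V1 & k in V2]%R v = inf_fun V1 v + inf_fun V2 v.
Proof.
move=> V10 V20; rewrite /inf_fun !ereal_inf_EFinN.
have supNy V : V !=set0 -> -oo < ereal_sup [set (- h v)%:E | h in V].
  by move=> V0; exact: (ereal_sup_EFin_gtNy (fun h : X -> R^o => - h v)%R).
(* Opposites distribute over a sum unless it has the form [+oo - oo]; here neither supremum is
   [-oo], as both sets are nonempty. *)
rewrite -oppeD; last first.
  by rewrite /adde_def (gt_eqF (supNy _ V10)) (gt_eqF (supNy _ V20)) andbF.
rewrite -(ereal_supD (fun h : X -> R^o => - h v)%R (fun h : X -> R^o => - h v)%R)//.
congr (- ereal_sup _); apply/seteqP; split.
- move=> _ [_ [h Uh [k Uk <-]] <-]; exists h => //; exists k => //.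
  by rewrite -opprD.
- move=> _ [h Uh [k Uk <-]]; exists (h + k)%R; first by exists h => //; exists k.
  by rewrite -opprD.
Qed.

Lemma sup_fun_scale_gt0 U v (a : R) : (0 < a)%R ->
  sup_fun [set a *: h | h in U]%R v = a%:E * sup_fun U v.
Proof.
by move=> a0; rewrite /sup_fun -ereal_sup_EFinZ// image_comp.
Qed.

Lemma inf_fun_scale_gt0 V v (a : R) : (0 < a)%R ->
  inf_fun [set a *: h | h in V]%R v = a%:E * inf_fun V v.
Proof.
move=> a0; rewrite /inf_fun !ereal_inf_EFinN muleN -ereal_sup_EFinZ// image_comp.
by congr (- ereal_sup _); apply: eq_imagel => h _ /=; rewrite mulrN.
Qed.

(** Writing [a * h] as [(- a) * (- h)] reduces to a positive factor, and the supremum of the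
    opposites is the opposite of the infimum. *)
Lemma sup_fun_scale_lt0 V v (a : R) : (a < 0)%R ->
  sup_fun [set a *: h | h in V]%R v = a%:E * inf_fun V v.
Proof.
move=> a0; rewrite /sup_fun /inf_fun ereal_inf_EFinN muleN -mulNe -EFinN.
rewrite -ereal_sup_EFinZ ?oppr_gt0// image_comp.
by congr (ereal_sup _); apply: eq_imagel => h _ /=; rewrite mulrNN.
Qed.

Lemma inf_fun_scale_lt0 U v (a : R) : (a < 0)%R ->
  inf_fun [set a *: h | h in U]%R v = a%:E * sup_fun U v.
Proof.
move=> a0; rewrite /sup_fun /inf_fun ereal_inf_EFinN -[a in RHS]opprK EFinN mulNe.
rewrite -ereal_sup_EFinZ ?oppr_gt0// image_comp.
by congr (- ereal_sup _); apply: eq_imagel => h _ /=; rewrite mulNr.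
Qed.

Lemma sup_fun_set1_0 : sup_fun [set 0%R] = cst 0 :> (X -> \bar R).
Proof. by apply/funext => v; rewrite /sup_fun image_set1 ereal_sup1. Qed.

Lemma inf_fun_set1_0 : inf_fun [set 0%R] = cst 0 :> (X -> \bar R).
Proof. by apply/funext => v; rewrite /inf_fun image_set1 ereal_inf1. Qed.

End SupInfFun.

(** * Pairs of functions and of generating sets, their equivalence and operations *)

Section Pairs.
Context {R : realType} {X : normedModType R}.
Implicit Types (H : set (X -> R^o)) (p q : @fpair R X) (s t : @spair R X).

(* Junk value 0 where the sum is infinite. *)
Definition fpair_val p (v : X) : R := fine (p.1 v + p.2 v).

Lemma fpair_valE p v : edom p.1 v -> edom p.2 v ->
  (p.1 v + p.2 v)%E = (fpair_val p v)%:E.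
Proof. by move=> p1 p2; rewrite /fpair_val fineK// fin_numD; apply/andP. Qed.

(** The finiteness clause of [PF] alone, free of [H]; it turns extended real identities into real
    ones near 0. *)
Definition finite_near0 p := nbhs 0 (edom p.1 `&` edom p.2).

Lemma PF_finite_near0 H p : PF H p -> finite_near0 p.
Proof. by case. Qed.

Lemma PFset_PF H s : PFset H s -> PF H (fpair_of s).
Proof. by case. Qed.

(** Allows closure properties of [PF] to be proved on generating sets. *)
Lemma PF_PFset H p : PF H p -> exists2 s, PFset H s & p = fpair_of s.
Proof.
case: p => p1 p2 [[U [UH U0 /= p1E]] [V [VH V0 /= p2E]] p0].
exists (U, V); last by rewrite /fpair_of -p1E -p2E.
split=> //; split; [by exists U|by exists V|].
by rewrite /fpair_of /= -p1E -p2E.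
Qed.

Lemma fpair_val0E p : finite_near0 p -> (p.1 0%R + p.2 0%R)%E = (fpair_val p 0)%:E.
Proof. by move=> /nbhs_singleton[? ?]; exact: fpair_valE. Qed.

(** On a ray all four functions are finite for small [a], so the extended quotient in [sigma_w] is
    eventually the real one and the two limits are the same. *)
Lemma sigma_wP p q : finite_near0 p -> finite_near0 q ->
  sigma_w p q <-> fpair_val p 0 = fpair_val q 0 /\
    radial_littleo (fun v => fpair_val p v - fpair_val q v).
Proof.
move=> p0 q0; rewrite /sigma_w !fpair_val0E//.
suff pqE v : ((a^-1)%:E * (p.1 (a *: v) + p.2 (a *: v) - q.1 (a *: v) - q.2 (a *: v)))%E
      @[a --> (0 : R)^'+] --> 0%E <->
    (fpair_val p (a *: v) - fpair_val q (a *: v)) / a @[a --> (0 : R)^'+] --> (0 : R).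
  split=> [[[->] pq]|[-> /radial_littleoP pq]]; split=> //.
    by apply/radial_littleoP => v; apply/pqE.
  by move=> v; apply/pqE.
have pq_near : \forall a \near (0 : R)^'+,
    ((a^-1)%:E * (p.1 (a *: v) + p.2 (a *: v) - q.1 (a *: v) - q.2 (a *: v)))%E =
    ((fpair_val p (a *: v) - fpair_val q (a *: v)) / a)%:E.
  apply: filterS2 (near_ray v p0) (near_ray v q0) => a [p1 p2] [q1 q2].
  have fq2 : q.2 (a *: v) \is a fin_num by [].
  (* Merging the two subtractions into one needs the finiteness of [q.2] recorded above. *)
  by rewrite -addeA -oppeD ?fin_num_adde_defl// !fpair_valE// -EFinB -EFinM mulrC.
split.
  move=> /fine_cvgP[_]; apply: cvg_trans; apply: near_eq_cvg.
  by apply: filterS pq_near => a /= ->.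
move=> pq; have : ((fpair_val p (a *: v) - fpair_val q (a *: v)) / a)%:E
    @[a --> (0 : R)^'+] --> (0 : R)%:E.
  by apply: cvg_EFin => //; exact: nearW.
apply: cvg_trans; apply: near_eq_cvg.
by apply: filterS pq_near => a /= ->.
Qed.

Lemma sigma_w_refl p : finite_near0 p -> sigma_w p p.
Proof.
move=> p0; apply/sigma_wP => //; split=> // v eps eps0.
near=> a; rewrite subrr normr0 mulr_ge0 ?ltW//.
Unshelve. all: by end_near. Qed.

Lemma sigma_w_sym p q : finite_near0 p -> finite_near0 q ->
  sigma_w p q -> sigma_w q p.
Proof.
move=> p0 q0 /sigma_wP[]// pq0 pq; apply/sigma_wP => //; split=> //.
apply: eq_near_radial_littleo (radial_littleoZ (-1) pq).
by apply: nearW => v; rewrite mulN1r opprB.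
Qed.

Lemma sigma_w_trans q p r : finite_near0 p -> finite_near0 q -> finite_near0 r ->
  sigma_w p q -> sigma_w q r -> sigma_w p r.
Proof.
move=> p0 q0 r0 /sigma_wP[]// pq0 pq /sigma_wP[]// qr0 qr.
apply/sigma_wP => //; split; first by rewrite pq0.
apply: eq_near_radial_littleo (radial_littleoD pq qr).
by apply: nearW => v; rewrite addrA subrK.
Qed.

Lemma fclass_self H p : PF H p -> fclass H p p.
Proof. by move=> Hp; split=> //; apply: sigma_w_refl; case: Hp. Qed.

Lemma sclass_self H s : PFset H s -> sclass H s s.
Proof. by move=> Hs; split=> //; apply: sigma_w_refl; case: Hs => _ _ _ _ []. Qed.

Lemma eq_fclass H p q : PF H p -> PF H q -> sigma_w p q -> fclass H p = fclass H q.
Proof.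
move=> /PF_finite_near0 p0 /PF_finite_near0 q0 pq; apply/seteqP.
split=> r [Hr] /=; have r0 := PF_finite_near0 Hr => ?; split=> //.
  by apply: (@sigma_w_trans p) => //; exact: sigma_w_sym.
exact: (@sigma_w_trans q).
Qed.

Lemma eq_sclass H s t : PFset H s -> PFset H t ->
  sigma_w (fpair_of s) (fpair_of t) -> sclass H s = sclass H t.
Proof.
move=> /PFset_PF/PF_finite_near0 s0 /PFset_PF/PF_finite_near0 t0 st; apply/seteqP.
split=> r [Hr] /=; have r0 := PF_finite_near0 (PFset_PF Hr) => ?; split=> //.
  by apply: (@sigma_w_trans (fpair_of s)) => //; exact: sigma_w_sym.
exact: (@sigma_w_trans (fpair_of t)).
Qed.

Lemma fpair_val_zero v : fpair_val fpair_zero v = 0.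
Proof. by rewrite /fpair_val /= addr0. Qed.

Lemma finite_near0_zero : finite_near0 fpair_zero.
Proof. exact: nearW. Qed.

Lemma finite_near0_add p q : finite_near0 p -> finite_near0 q ->
  finite_near0 (fpair_add p q).
Proof.
apply: filterS2 => v [p1 p2] [q1 q2].
by split; rewrite /edom /= fin_numD; apply/andP.
Qed.

Lemma finite_near0_scale (a : R) p : finite_near0 p ->
  finite_near0 (fpair_scale a p).
Proof.
move=> p0; rewrite /fpair_scale; case: ifPn => _; [|case: ifPn => _].
- by apply: filterS p0 => v [p1 p2]; split; rewrite /edom /= fin_numM.
- by apply: filterS p0 => v [p1 p2]; split; rewrite /edom /= fin_numM.
- exact: finite_near0_zero.
Qed.

Lemma fpair_val_add p q : finite_near0 p -> finite_near0 q ->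
  \forall v \near 0, fpair_val (fpair_add p q) v = fpair_val p v + fpair_val q v.
Proof.
apply: filterS2 => v [p1 p2] [q1 q2].
by rewrite /fpair_val /= addeACA fineD// fin_numD; apply/andP.
Qed.

(** Distributivity holds where both components are finite. For a negative factor the exchange of
    components only reorders the sum, so one formula covers every sign. *)
Lemma fpair_val_scale (a : R) p : finite_near0 p ->
  \forall v \near 0, fpair_val (fpair_scale a p) v = a * fpair_val p v.
Proof.
apply: filterS => v [p1 p2].
have pE : fine (a%:E * p.1 v + a%:E * p.2 v)%E = a * fpair_val p v.
  by rewrite /fpair_val -muleDr ?fin_num_adde_defl// fineM// fin_numD; apply/andP.
rewrite /fpair_scale; case: ifPn => [_|a_le0]; first exact: pE.
case: ifPn => [_|a_ge0]; first by rewrite -pE /fpair_val addeC.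
rewrite fpair_val_zero (_ : a = 0) ?mul0r//.
by apply/eqP; rewrite eq_le !leNgt a_le0 a_ge0.
Qed.

Lemma sigma_w_add p p' q q' : finite_near0 p -> finite_near0 p' ->
  finite_near0 q -> finite_near0 q' -> sigma_w p p' -> sigma_w q q' ->
  sigma_w (fpair_add p q) (fpair_add p' q').
Proof.
move=> p0 p'0 q0 q'0 /sigma_wP[]// pp0 pp /sigma_wP[]// qq0 qq.
have add_val := fpair_val_add p0 q0; have add_val' := fpair_val_add p'0 q'0.
apply/sigma_wP; [exact: finite_near0_add..|split].
  by rewrite (nbhs_singleton add_val) (nbhs_singleton add_val') pp0 qq0.
apply: eq_near_radial_littleo (radial_littleoD pp qq).
by apply: filterS2 add_val add_val' => v -> ->; ring.
Qed.

Lemma sigma_w_scale (a : R) p q : finite_near0 p -> finite_near0 q ->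
  sigma_w p q -> sigma_w (fpair_scale a p) (fpair_scale a q).
Proof.
move=> p0 q0 /sigma_wP[]// pq0 pq.
have scale_p := fpair_val_scale a p0; have scale_q := fpair_val_scale a q0.
apply/sigma_wP; [exact: finite_near0_scale..|split].
  by rewrite (nbhs_singleton scale_p) (nbhs_singleton scale_q) pq0.
apply: eq_near_radial_littleo (radial_littleoZ a pq).
by apply: filterS2 scale_p scale_q => v -> ->; ring.
Qed.

Lemma fpair_of_zero : fpair_of spair_zero = fpair_zero :> @fpair R X.
Proof. by rewrite /fpair_of /= sup_fun_set1_0 inf_fun_set1_0. Qed.

Lemma fpair_of_add H s t : PFset H s -> PFset H t ->
  fpair_of (spair_add s t) = fpair_add (fpair_of s) (fpair_of t).
Proof.
move=> [_ s1 _ s2 _] [_ t1 _ t2 _].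
by congr pair; apply/funext => v; [exact: sup_fun_add|exact: inf_fun_add].
Qed.

(** A negative factor exchanges suprema and infima, which is matched by the exchange of components
    in both scalings. *)
Lemma fpair_of_scale (a : R) s :
  fpair_of (spair_scale a s) = fpair_scale a (fpair_of s).
Proof.
rewrite /spair_scale /fpair_scale; case: ifPn => [a0|_].
  by congr pair; apply/funext => v;
    [exact: sup_fun_scale_gt0|exact: inf_fun_scale_gt0].
case: ifPn => [a0|_]; last exact: fpair_of_zero.
by congr pair; apply/funext => v;
  [exact: sup_fun_scale_lt0|exact: inf_fun_scale_lt0].
Qed.

Lemma PFset_intro H s : s.1 `<=` H -> s.1 !=set0 -> s.2 `<=` H -> s.2 !=set0 ->
  finite_near0 (fpair_of s) -> PFset H s.
Proof.
move=> s1H s1 s2H s2 s0; split=> //.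
by split; [exists s.1|exists s.2|].
Qed.

(** * Operations on classes over a linear subspace are well defined *)

Section LinearSubspace.
Variable H : set (X -> R^o).
Hypothesis Hlin : linear_subspace H.

Let H0 : H 0.
Proof. by have [] := Hlin; rewrite inE. Qed.

Let HD h k : H h -> H k -> H (h + k).
Proof. by case: Hlin => _ + Hh Hk => /(_ 1 h k); rewrite !inE scale1r; apply. Qed.

Let HZ (a : R) h : H h -> H (a *: h).
Proof. by case: Hlin => _ + Hh => /(_ a h 0); rewrite !inE addr0; apply. Qed.

Lemma PFset_zero : PFset H spair_zero.
Proof.
apply: PFset_intro => //=; try by [exists 0 | move=> _ ->].
by rewrite fpair_of_zero; exact: finite_near0_zero.
Qed.

Lemma PFset_add s t : PFset H s -> PFset H t -> PFset H (spair_add s t).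
Proof.
move=> Hs Ht; apply: PFset_intro.
- by case: Hs Ht => [sH _ _ _ _] [tH _ _ _ _] _ [h sh [k tk <-]];
    apply: HD; [exact: sH|exact: tH].
- by case: Hs Ht => [_ [h sh] _ _ _] [_ [k tk] _ _ _]; exists (h + k); exists h => //; exists k.
- by case: Hs Ht => [_ _ sH _ _] [_ _ tH _ _] _ [h sh [k tk <-]];
    apply: HD; [exact: sH|exact: tH].
- by case: Hs Ht => [_ _ _ [h sh] _] [_ _ _ [k tk] _]; exists (h + k); exists h => //; exists k.
- by rewrite (fpair_of_add Hs Ht); apply: finite_near0_add;
    apply: PF_finite_near0; apply: PFset_PF; eassumption.
Qed.

Lemma PFset_scale (a : R) s : PFset H s -> PFset H (spair_scale a s).
Proof.
move=> Hs; have [sH1 [h1 sh1] sH2 [h2 sh2] /PF_finite_near0 s0] := Hs.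
have := finite_near0_scale a s0; rewrite -fpair_of_scale.
rewrite /spair_scale; case: ifPn => [_|_ ]; last case: ifPn => [_|_ _];
  last exact: PFset_zero.
- apply: PFset_intro => /=; [|by exists (a *: h1); exists h1| |by exists (a *: h2); exists h2].
    by move=> _ [h sh <-]; apply: HZ; exact: sH1.
  by move=> _ [h sh <-]; apply: HZ; exact: sH2.
- apply: PFset_intro => /=; [|by exists (a *: h2); exists h2| |by exists (a *: h1); exists h1].
    by move=> _ [h sh <-]; apply: HZ; exact: sH2.
  by move=> _ [h sh <-]; apply: HZ; exact: sH1.
Qed.

Lemma PF_add p q : PF H p -> PF H q -> PF H (fpair_add p q).
Proof.
move=> /PF_PFset[s Hs ->] /PF_PFset[t Ht ->].
by rewrite -(fpair_of_add Hs Ht); apply: PFset_PF; exact: PFset_add.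
Qed.

Lemma PF_scale (a : R) p : PF H p -> PF H (fpair_scale a p).
Proof.
move=> /PF_PFset[s Hs ->].
by rewrite -fpair_of_scale; apply: PFset_PF; exact: PFset_scale.
Qed.

(** Equivalent summands give equivalent sums, so all classes in the union defining [fclass_add]
    coincide; [p] and [q] themselves show that the union is nonempty. *)
Lemma fclass_add_fclass p q : PF H p -> PF H q ->
  fclass_add H (fclass H p) (fclass H q) = fclass H (fpair_add p q).
Proof.
move=> Hp Hq; have PF0 := @PF_finite_near0 H; apply/seteqP; split.
  move=> r [p' [Hp' pp']] [q' [Hq' qq']].
  rewrite (@eq_fclass H (fpair_add p' q') (fpair_add p q))//; try exact: PF_add.
  by apply: sigma_w_sym; [apply/PF0/PF_add..|apply: sigma_w_add => //; exact: PF0].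
by move=> r Hr; exists p; [exact: fclass_self|exists q; [exact: fclass_self|]].
Qed.

Lemma fclass_scale_fclass (a : R) p : PF H p ->
  fclass_scale H a (fclass H p) = fclass H (fpair_scale a p).
Proof.
move=> Hp; have PF0 := @PF_finite_near0 H; apply/seteqP; split.
  move=> r [p' [Hp' pp']].
  rewrite (@eq_fclass H (fpair_scale a p') (fpair_scale a p))//; try exact: PF_scale.
  by apply: sigma_w_sym; [apply/PF0/PF_scale..|apply: sigma_w_scale => //; exact: PF0].
by move=> r Hr; exists p; [exact: fclass_self|].
Qed.

Lemma sclass_add_sclass s t : PFset H s -> PFset H t ->
  sclass_add H (sclass H s) (sclass H t) = sclass H (spair_add s t).
Proof.
move=> Hs Ht; have PF0 u (Hu : PFset H u) := PF_finite_near0 (PFset_PF Hu).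
apply/seteqP; split.
  move=> r [s' [Hs' ss']] [t' [Ht' tt']].
  rewrite (@eq_sclass H (spair_add s' t') (spair_add s t))//; try exact: PFset_add.
  apply: sigma_w_sym; [exact/PF0/PFset_add..|].
  by rewrite (fpair_of_add Hs Ht) (fpair_of_add Hs' Ht'); apply: sigma_w_add => //; exact: PF0.
by move=> r Hr; exists s; [exact: sclass_self|exists t; [exact: sclass_self|]].
Qed.

Lemma sclass_scale_sclass (a : R) s : PFset H s ->
  sclass_scale H a (sclass H s) = sclass H (spair_scale a s).
Proof.
move=> Hs; have PF0 u (Hu : PFset H u) := PF_finite_near0 (PFset_PF Hu).
apply/seteqP; split.
  move=> r [s' [Hs' ss']].
  rewrite (@eq_sclass H (spair_scale a s') (spair_scale a s))//; try exact: PFset_scale.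
  apply: sigma_w_sym; [exact/PF0/PFset_scale..|].
  by rewrite !fpair_of_scale; apply: sigma_w_scale => //; exact: PF0.
by move=> r Hr; exists s; [exact: sclass_self|].
Qed.

(** * Representatives of linear combinations of classes *)

Section LinearCombination.
Variables (d : nat) (c : 'I_d -> R) (s : 'I_d -> @spair R X).
Hypothesis Hs : forall i, PFset H (s i).

(** One explicit pair of sets that serves as representative both for the combination of set classes
    and, through [fpair_of], for that of function classes. *)
Definition spair_comb : @spair R X :=
  \big[spair_add / spair_zero]_(i < d) spair_scale (c i) (s i).

Lemma PFset_comb : PFset H spair_comb.
Proof.
apply: (big_ind (PFset H)) => [|? ?|i _]; [exact: PFset_zero|exact: PFset_add|].
exact: PFset_scale.
Qed.

Lemma fclass_comb : fclass H (fpair_of spair_comb) =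
  \big[fclass_add H / fclass_zero H]_(i < d)
    fclass_scale H (c i) (fclass H (fpair_of (s i))).
Proof.
suff [] : PFset H spair_comb /\ fclass H (fpair_of spair_comb) =
    \big[fclass_add H / fclass_zero H]_(i < d)
      fclass_scale H (c i) (fclass H (fpair_of (s i))) by [].
(* Membership in [PFset] is carried along the induction because reducing a sum of classes to
   representatives requires it of the partial combination. *)
apply: (big_rec2 (fun u A => PFset H u /\ fclass H (fpair_of u) = A)) => [|i A u _ [Hu <-]].
  by rewrite fpair_of_zero; split=> //; exact: PFset_zero.
split; first by apply: PFset_add => //; exact: PFset_scale.
rewrite (fpair_of_add (PFset_scale _ (Hs i)) Hu) fpair_of_scale.
by rewrite fclass_scale_fclass ?fclass_add_fclass//; try apply: PF_scale; exact: PFset_PF.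
Qed.

Lemma sclass_comb : sclass H spair_comb =
  \big[sclass_add H / sclass_zero H]_(i < d)
    sclass_scale H (c i) (sclass H (s i)).
Proof.
suff [] : PFset H spair_comb /\ sclass H spair_comb =
    \big[sclass_add H / sclass_zero H]_(i < d)
      sclass_scale H (c i) (sclass H (s i)) by [].
apply: (big_rec2 (fun u A => PFset H u /\ sclass H u = A)) => [|i A u _ [Hu <-]].
  by split=> //; exact: PFset_zero.
split; first by apply: PFset_add => //; exact: PFset_scale.
by rewrite sclass_scale_sclass ?sclass_add_sclass//; exact: PFset_scale.
Qed.

Lemma fpair_val_comb : \forall v \near 0,
  fpair_val (fpair_of spair_comb) v = \sum_i c i * fpair_val (fpair_of (s i)) v.
Proof.
(* Summing in the function space makes the near equality a relation between whole partial sums, so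
   each induction step intersects finitely many neighbourhoods. *)
pose f := \sum_i (fun v => c i * fpair_val (fpair_of (s i)) v) : X -> R.
suff [_] : PFset H spair_comb /\
    \forall v \near 0, fpair_val (fpair_of spair_comb) v = f v.
  by apply: filterS => v ->; rewrite /f fct_sumE.
apply: (big_rec2 (fun u g => PFset H u /\
    \forall v \near 0, fpair_val (fpair_of u) v = g v)) => [|i g u _ [Hu ug]].
  split; first exact: PFset_zero.
  by apply: nearW => v; rewrite fpair_of_zero fpair_val_zero.
have Hsi := PFset_scale (c i) (Hs i).
split; first exact: PFset_add.
have PF0 t (Ht : PFset H t) := PF_finite_near0 (PFset_PF Ht).
rewrite (fpair_of_add Hsi Hu).
near=> v; rewrite (near (fpair_val_add (PF0 _ Hsi) (PF0 _ Hu)) v)//.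
rewrite (near ug v)// fpair_of_scale.
by rewrite (near (fpair_val_scale (c i) (PF0 _ (Hs i))) v).
Unshelve. all: by end_near. Qed.

End LinearCombination.
End LinearSubspace.
End Pairs.

(** * Weak expansions and uniqueness of the derivative and codifferential *)

Section Expansions.
Context {R : realType} {X : normedModType R}.
Implicit Types (H : set (X -> R^o)) (Omega : set X) (F : X -> R) (x : X).
Implicit Types (p q : @fpair R X) (s t : @spair R X).

(** The hull conditions hold for all [v] near 0, and a radial condition is insensitive to shrinking
    [v]. Conversely, the remainder is simply the difference. *)
Lemma weak_expansionP H Omega F x p : open Omega -> Omega x -> PF H p ->
  weak_expansion H Omega F x p <->
  fpair_val p 0 = 0 /\ radial_littleo (fun v => F (x + v) - F x - fpair_val p v).
Proof.
move=> oOmega xOmega Hp; have p0 := PF_finite_near0 Hp.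
have coO : \forall v \near 0, co [set x; x + v] `<=` Omega.
  by apply: near_co_sub; exact: open_nbhs_nbhs.
have cop : \forall v \near 0, co [set 0; v] `<=` edom p.1 `&` edom p.2.
  by apply: filterS (near_co_sub p0) => v; rewrite add0r.
split=> [[_ p00 [r rP]]|[p00 po]].
  split; first by move: p00; rewrite fpair_val0E// => -[].
  apply: (radial_littleo_dilate (filterI coO cop)) => v [vO vp] eps eps0.
  have [_ /(@cvgr0Pnorm_le R R^o)/(_ _ eps0) oa] := rP v vO vp.
  near=> a; have a0 : 0 < a by near: a; exact: nbhs_right_gt.
  have [eF _] : (F (x + a *: v) - F x)%:E =
      (p.1 (a *: v) + p.2 (a *: v) + (r (a *: v))%:E)%E /\
      r (b *: (a *: v)) / b @[b --> (0 : R)^'+] --> (0 : R).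
    by apply: rP; near: a; [exact: (near_ray v coO)|exact: (near_ray v cop)].
  have [pa1 pa2] : (edom p.1 `&` edom p.2) (a *: v) by near: a; exact: near_ray.
  move: eF; rewrite (fpair_valE pa1 pa2) => -[->]; rewrite addrAC subrr add0r.
  have : `|r (a *: v) / a| <= eps by near: a; exact: oa.
  by rewrite normrM normfV (gtr0_norm a0) ler_pdivrMr.
split=> //; first by rewrite fpair_val0E// p00.
exists (fun v => F (x + v) - F x - fpair_val p v) => v _ vp; split.
  have [pv1 pv2] : (edom p.1 `&` edom p.2) v.
    (* The endpoint [v] lies in every convex set containing the two points, hence in their hull. *)
    by apply: vp => C [_]; apply; right.
  by rewrite (fpair_valE pv1 pv2) -EFinD subrKC.
by have /radial_littleoP := po; exact.
Unshelve. all: by end_near. Qed.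

Section WeakDerivative.
Variables (H : set (X -> R^o)) (Omega : set X) (F : X -> R) (x : X).
Hypotheses (oOmega : open Omega) (xOmega : Omega x).

(** Subtracting the two expansions cancels the increment of [F] and leaves a radial little-o. *)
Lemma weak_expansion_sigma_w p q :
  weak_expansion H Omega F x p -> weak_expansion H Omega F x q -> sigma_w p q.
Proof.
move=> ep eq; have [Hp _ _] := ep; have [Hq _ _] := eq.
move/weak_expansionP: ep => -[]// p0 po; move/weak_expansionP: eq => -[]// q0 qo.
apply/sigma_wP; [exact: PF_finite_near0 Hp|exact: PF_finite_near0 Hq|split].
  by rewrite p0 q0.
apply: eq_near_radial_littleo (radial_littleoD qo (radial_littleoZ (-1) po)).
by apply: nearW => v; ring.
Qed.

(** By uniqueness up to [sigma_w] the value picked by [xget] does not depend on the expansion. *)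
Lemma weak_derivativeE p : weak_expansion H Omega F x p ->
  weak_derivative H Omega F x = fclass H p.
Proof.
move=> ep; rewrite /weak_derivative; case: xgetP => [_ _ [q eq ->]|/(_ (fclass H p))].
  have [Hp _ _] := ep; have [Hq _ _] := eq.
  by apply: eq_fclass => //; exact: weak_expansion_sigma_w.
by case; exists p.
Qed.

(** Used to pass from an arbitrary expansion to the Lipschitz representative of its class. *)
Lemma weak_expansion_fclass p q : weak_expansion H Omega F x p ->
  fclass H p q -> weak_expansion H Omega F x q.
Proof.
move=> ep [Hq pq]; have [Hp _ _] := ep.
have /(sigma_wP (PF_finite_near0 Hp) (PF_finite_near0 Hq))[pq0 {}pq] := pq.
move/weak_expansionP: ep => -[]// p0 po.
apply/weak_expansionP => //; split; first by rewrite -pq0.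
apply: eq_near_radial_littleo (radial_littleoD po pq).
by apply: nearW => v; ring.
Qed.

(** Whatever sets [xget] picks, they generate a pair in the class of [fpair_of s], and set classes
    compare only the associated pairs. *)
Lemma weak_codifferentialE s : PFset H s ->
  weak_derivative H Omega F x = fclass H (fpair_of s) ->
  weak_codifferential H Omega F x = sclass H s.
Proof.
move=> Hs DE; rewrite /weak_codifferential DE.
case: xgetP => [_ _ [t [q [Dq [tH1 t1 tq1] [tH2 t2 tq2] ->]]]|/(_ (sclass H s))].
  have qE : q = fpair_of t by rewrite /fpair_of -tq1 -tq2; case: (q).
  move: Dq; rewrite qE => -[Hq sq].
  have Ht : PFset H t by [].
  apply/esym; exact: eq_sclass.
case; exists s, (fpair_of s); have Ds := fclass_self (PFset_PF Hs).
by case: Hs => *; split.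
Qed.

End WeakDerivative.
End Expansions.

(** * The chain rule along rays and its transfer to classes *)

Section ChainRule.
Context {R : realType} {X : normedModType R}.

(** The differential is linear, so decomposing [h] in the canonical basis turns it into the sum of
    partial derivatives. *)
Lemma differentiable_row_expansion d (g : 'rV[R]_d -> R) (y : 'rV[R]_d) (eps : R) :
  differentiable g y -> 0 < eps ->
  \forall h \near (0 : 'rV[R]_d),
    `|g (y + h) - g y - \sum_i partial_derivative i g y * h 0 i| <= eps * `|h|.
Proof.
move=> dg eps0; have /eqaddoP/(_ _ eps0) := diff_locally dg.
apply: filterS => h /=; apply: le_trans.
rewrite !fctE/= [h + y]addrC le_eqVlt; apply/orP; left; apply/eqP; congr `|_|.
rewrite opprD addrA; congr (_ - _).
rewrite [in RHS](row_sum_delta h) linear_sum; apply: eq_bigr => i _.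
by rewrite linearZ /= -deriveE// mulrC.
Qed.

(** The norm on row vectors is the maximum norm; [0 <= M] covers the empty row. *)
Lemma row_norm_le d (h : 'rV[R]_d) (M : R) : 0 <= M ->
  (forall i, `|h 0 i| <= M) -> `|h| <= M.
Proof.
move=> M0 hM; rewrite [leLHS]/Num.Def.normr /= mx_normrE.
by apply/bigmax_leP; split=> // -[i j] _ /=; rewrite (ord1 i).
Qed.

Lemma radial_chain_rule d (F phi : 'I_d -> X -> R) (x : X) (g : 'rV[R]_d -> R) :
  let y := \row_i F i x in
  differentiable g y ->
  (forall i, radial_littleo (fun v => F i (x + v) - F i x - phi i v)) ->
  (forall i v, exists C : R, \forall a \near (0 : R)^'+, `|phi i (a *: v)| <= C * a) ->
  radial_littleo (fun v => g (\row_i F i (x + v)) - g y -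
    \sum_i partial_derivative i g y * phi i v).
Proof.
move=> y dg Fo phiO; pose h v : 'rV[R]_d := \row_i F i (x + v) - y.
have hE v i : h v 0 i = F i (x + v) - F i x by rewrite !mxE.
(* Replacing [phi i] by the true increments [h v 0 i] changes the sum by a linear combination of the
   radial little-o terms in [Fo]. *)
suff go : radial_littleo (fun v => g (y + h v) - g y -
    \sum_i partial_derivative i g y * h v 0 i).
  have so := radial_littleo_sum
    (fun i => radial_littleoZ (partial_derivative i g y) (Fo i)).
  apply: eq_near_radial_littleo (radial_littleoD go so); apply: nearW => v.
  rewrite (_ : y + h v = \row_i F i (x + v)) ?subrKC// -addrA; congr (_ + _).
  rewrite -sumrN -big_split/= -sumrN; apply: eq_bigr => i _.
  by rewrite hE; ring.
have hO v : exists2 C : R, 0 < C & \forall a \near (0 : R)^'+, `|h (a *: v)| <= C * a.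
  have /choice[C CP] := fun i => phiO i v.
  (* The 1 bounds the remainder of each expansion, taken with tolerance 1, and keeps the constant
     positive; the sum dominates each [C i]. *)
  exists (1 + \sum_i `|C i|); first by rewrite ltr_wpDr// sumr_ge0.
  have hi : \forall a \near (0 : R)^'+, forall i, `|h (a *: v) 0 i| <= (1 + `|C i|) * a.
    apply: filter_forall => i; near=> a.
    have a0 : 0 < a by near: a; exact: nbhs_right_gt.
    rewrite hE -[X in `|X|](subrK (phi i (a *: v))) (le_trans (ler_normD _ _))//.
    rewrite mulrDl lerD//; first by near: a; exact: Fo.
    apply: (@le_trans _ _ (C i * a)); first by near: a; exact: CP.
    by rewrite ler_wpM2r ?ler_norm ?ltW.
  near=> a; have a0 : 0 < a by near: a; exact: nbhs_right_gt.
  have hia : forall i, `|h (a *: v) 0 i| <= (1 + `|C i|) * a by near: a.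
  apply: row_norm_le => [|i].
    by rewrite mulr_ge0 ?ltW// ltr_wpDr// sumr_ge0.
  apply: le_trans (hia i) _.
  by rewrite ler_wpM2r ?lerD2l ?(ltW a0)// (bigD1 i)//= lerDl sumr_ge0.
move=> v eps eps0; have [C C0 hC] := hO v.
(* With [h (a *: v)] of norm at most [C * a], the tolerance [eps / C] yields [eps * a]; taking
   [a < r / C] keeps the increment in the ball of radius [r]. *)
have /nbhs_norm0P[r /= r0 gr] := differentiable_row_expansion dg (divr_gt0 eps0 C0).
near=> a; have a0 : 0 < a by near: a; exact: nbhs_right_gt.
have hCa : `|h (a *: v)| <= C * a by near: a.
apply: le_trans (gr (h (a *: v)) _) _.
  rewrite /= (le_lt_trans hCa)// mulrC -ltr_pdivlMr//.
  by near: a; apply: nbhs_right_lt; rewrite divr_gt0.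
apply: (@le_trans _ _ (eps / C * (C * a))).
  by rewrite ler_wpM2l// ltW// divr_gt0.
by rewrite mulrA divfK ?gt_eqF.
Unshelve. all: by end_near. Qed.

Lemma lipschitz_near0_ray (f : X -> \bar R) v : lipschitz_near0 f ->
  exists C : R, \forall a \near (0 : R)^'+,
    `|fine (f (a *: v)) - fine (f 0)| <= C * a.
Proof.
(* The Lipschitz bound is available for every constant strictly above [M], whence [M + 1]. *)
move=> [N N0 [_ [M [_ fM]]]]; exists ((M + 1) * `|v|); near=> a.
have a0 : 0 < a by near: a; exact: nbhs_right_gt.
have Nav : N (a *: v) by near: a; exact: near_ray.
have M1 : M < M + 1 by rewrite ltrDl.
have := fM _ M1 (a *: v, 0) (conj Nav (nbhs_singleton N0)).
by rewrite /= subr0 normrZ (gtr0_norm a0) -mulrA [_ * a]mulrC.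
Unshelve. all: by end_near. Qed.

(** As the value at 0 vanishes, the value at [a *: v] is itself an increment, bounded by the two
    Lipschitz estimates. *)
Lemma fpair_val_ray (p : @fpair R X) v : finite_near0 p ->
  lipschitz_near0 p.1 -> lipschitz_near0 p.2 -> fpair_val p 0 = 0 ->
  exists C : R, \forall a \near (0 : R)^'+, `|fpair_val p (a *: v)| <= C * a.
Proof.
move=> p0 /(lipschitz_near0_ray v)[C1 hC1] /(lipschitz_near0_ray v)[C2 hC2] p00.
have pE w : edom p.1 w -> edom p.2 w ->
    fpair_val p w = fine (p.1 w) + fine (p.2 w) by exact: fineD.
exists (C1 + C2); near=> a.
have [pa1 pa2] : (edom p.1 `&` edom p.2) (a *: v) by near: a; exact: near_ray.
have [p01 p02] := nbhs_singleton p0.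
rewrite -[X in `|X|]subr0 -p00 !pE// opprD addrACA mulrDl.
by rewrite (le_trans (ler_normD _ _))// lerD//; near: a.
Unshelve. all: by end_near. Qed.

End ChainRule.

Theorem theorem4p7 (R : realType) (X : normedModType R) (Omega : set X)
  (H : set (X -> R^o)) (d : nat) (F : 'I_d -> X -> R) (x : X)
  (S : set 'rV[R]_d) (g : 'rV[R]_d -> R) (O : set X)
  (hOmega : open Omega)
  (hH : linear_subspace H)
  (hx : Omega x)
  (hF : forall i, weakly_codifferentiable H Omega (F i) x)
  (hL : forall i, fclass_lipschitz (weak_derivative H Omega (F i) x))
  (hS : open S)
  (hy : S (\row_i F i x))
  (hg : differentiable g (\row_i F i x))
  (hO : open O)
  (hOOmega : O `<=` Omega)
  (hxO : O x)
  (hT : forall z, O z -> S (\row_i F i z)) :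
  let y := \row_i F i x in
  let T := fun z => g (\row_i F i z) in
  [/\ weakly_codifferentiable H O T x,
      weak_derivative H O T x =
        \big[fclass_add H / fclass_zero H]_(i < d)
          fclass_scale H (partial_derivative i g y)
            (weak_derivative H Omega (F i) x) &
      weak_codifferential H O T x =
        \big[sclass_add H / sclass_zero H]_(i < d)
          sclass_scale H (partial_derivative i g y)
            (weak_codifferential H Omega (F i) x)].
Proof.
move=> y T; pose c i := partial_derivative i g y.
(* Sets generating a Lipschitz representative of each derivative; that representative is again an
   expansion, being equivalent to one. *)
have /choice[s sP] : forall i, exists s,
    [/\ PFset H s, weak_expansion H Omega (F i) x (fpair_of s),
        lipschitz_near0 (fpair_of s).1 & lipschitz_near0 (fpair_of s).2].
  move=> i; have [q eq] := hF i; have [p pq [p1 p2]] := hL i.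
  rewrite (weak_derivativeE hOmega hx eq) in pq.
  have ep := weak_expansion_fclass hOmega hx eq pq.
  by have [/PF_PFset[s Hs ps] _ _] := ep; exists s; split=> //; rewrite -ps.
have Hs i : PFset H (s i) by have [] := sP i.
have es i : weak_expansion H Omega (F i) x (fpair_of (s i)) by have [] := sP i.
have s0 i : fpair_val (fpair_of (s i)) 0 = 0 /\
    radial_littleo (fun v => F i (x + v) - F i x - fpair_val (fpair_of (s i)) v).
  by apply/(weak_expansionP (F i) hOmega hx (PFset_PF (Hs i))).
have HS := PFset_comb hH c Hs; have Sval := fpair_val_comb hH c Hs.
(* The radial characterisation of expansions does not mention the domain, so it applies on [O] as it
   did on [Omega]. *)
have eT : weak_expansion H O T x (fpair_of (spair_comb c s)).
  apply/(weak_expansionP T hO hxO (PFset_PF HS)); split.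
    rewrite (nbhs_singleton Sval) big1// => i _.
    by have [-> _] := s0 i; rewrite mulr0.
  have ray i v : exists C : R,
      \forall a \near (0 : R)^'+, `|fpair_val (fpair_of (s i)) (a *: v)| <= C * a.
    have [_ _ s1 s2] := sP i; have [si0 _] := s0 i.
    exact: fpair_val_ray (PF_finite_near0 (PFset_PF (Hs i))) s1 s2 si0.
  apply: eq_near_radial_littleo (radial_chain_rule hg (fun i => (s0 i).2) ray).
  by apply: filterS Sval => v ->.
have DT := weak_derivativeE hO hxO eT.
have DF i := weak_derivativeE hOmega hx (es i).
split; first by exists (fpair_of (spair_comb c s)).
  by rewrite DT (fclass_comb hH c Hs); apply: eq_bigr => i _; rewrite DF.
(* The generating sets behind the derivative also represent the codifferential, so no new choice is
   made. *)
rewrite (weak_codifferentialE HS DT) (sclass_comb hH c Hs); apply: eq_bigr => i _; congr sclass_scale.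
by rewrite (weak_codifferentialE (Hs i) (DF i)).
Qed.
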